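(* Let $k$ be a subfield of $\mathbb{C}$ and let $f\in k[x,y]$ be a tame polynomial. If all the singularities of the curve $f=0$ are quasi-homogeneous, then there exists $\omega_f\in E_f$ such that $f\,dx,\ f\,dy,\ df,\ \omega_f$ generate the $k[x,y]$-module $E_f$.
   Context: Tame polynomial: $f\in k[x,y]$ is called tame if there are positive integers $\alpha_1,\alpha_2$ such that, giving $k[x,y]$ the weights $\deg(x)=\alpha_1$, $\deg(y)=\alpha_2$ and writing $f=f_d+\cdots+f_1+f_0$ with $f_i$ weighted homogeneous of degree $i$ and $f_d\neq 0$, the top piece $g:=f_d$ has a finite dimensional Milnor vector space $V_g:=k[x,y]/\mathrm{jacob}(g)$, where $\mathrm{jacob}(g)=\langle \partial g/\partial x,\partial g/\partial y\rangle$. The module $E_f$: let $\Omega^i_{\mathbb{A}^2_k}$ be the $k[x,y]$-module of polynomial differential $i$-forms on $\mathbb{A}^2_k$. Then $$E_f:=\{\omega\in\Omega^1_{\mathbb{A}^2_k} \mid df\wedge\omega=f\alpha \text{ for some } \alpha\in\Omega^2_{\mathbb{A}^2_k}\}.$$ Quasi-homogeneous singularity: a germ of a curve singularity $h=0$, $h\in\mathcal{O}_{\mathbb{C}^2,0}$, is quasi-homogeneous if there is a holomorphic change of coordinates $(x,y)$ in $(\mathbb{C}^2,0)$ fixing the origin in which $h(x,y)=a(x,y)\,g(x,y)$ with $a\in\mathcal{O}_{\mathbb{C}^2,0}$, $a(0)\neq 0$, and $g$ a polynomial that is homogeneous in $\mathbb{C}[x,y]$ for some positive integer weights $\deg(x)=\alpha_1$,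 $\deg(y)=\alpha_2$. The singularities of $f=0$ are the points $p\in\mathbb{C}^2$ with $f(p)=\frac{\partial f}{\partial x}(p)=\frac{\partial f}{\partial y}(p)=0$, and quasi-homogeneity at $p$ refers to the germ of $f$ at $p$ (after translating $p$ to the origin). *)

(* Defs.v *)
From HB Require Import structures.
From mathcomp Require Import all_boot all_order all_algebra.
(* [mpoly] has to be imported before the analysis files: in the other order
   its notations are rejected. *)
From mathcomp Require Import mpoly.
From mathcomp Require Import boolp classical_sets functions reals topology.
From mathcomp Require Import normedtype sequences complex.

Set Implicit Arguments.
Unset Strict Implicit.
Unset Printing Implicit Defensive.

Import Order.TTheory GRing.Theory Num.Theory.
Import numFieldNormedType.Exports.

Local Open Scope classical_set_scope.
Local Open Scope ring_scope.
Local Open Scope complex_scope.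

(* The variables x and y are ['X_0] and ['X_1], the weight of ['X_i] is
   [alpha i]. *)
Definition wdeg (alpha : 'I_2 -> nat) (m : 'X_{1..2}) : nat :=
  (\sum_i alpha i * m i)%N.

Fact wdeg0 alpha : wdeg alpha 0%MM = 0%N.
Proof. by rewrite /wdeg big1 // => i _; rewrite mnm0E muln0. Qed.

Fact wdegD alpha :
  {morph wdeg alpha : m1 m2 / (m1 + m2)%MM >-> (m1 + m2)%N}.
Proof.
move=> m1 m2; rewrite /wdeg -big_split /=.
by apply: eq_bigr => i _; rewrite mnmDE mulnDr.
Qed.

HB.instance Definition _ alpha :=
  isMeasure.Build 2 (wdeg alpha) (wdeg0 alpha) (wdegD alpha).

Definition pos_weights (alpha : 'I_2 -> nat) : Prop := forall i, (0 < alpha i)%N.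

Section Algebra.
Variable k : fieldType.
Local Notation A := {mpoly k[2]}.

Definition jacob (g : A) : set A :=
  [set p | exists a b : A, p = a * g^`M(0) + b * g^`M(1)].

(* The [k]-vector space [k[x,y]/I] is spanned by the classes of finitely many
   polynomials. *)
Definition fin_dim_quotient (I : set A) : Prop :=
  exists (n : nat) (b : 'I_n -> A), forall p : A,
    exists c : 'I_n -> k, I (p - \sum_i c i *: b i).

Definition is_top_piece (alpha : 'I_2 -> nat) (f g : A) : Prop :=
  exists d : nat,
    [/\ g = pihomog (wdeg alpha) d f, g != 0
      & forall e, (d < e)%N -> pihomog (wdeg alpha) e f = 0].

Definition tame (f : A) : Prop :=
  exists alpha : 'I_2 -> nat, pos_weights alpha /\
    exists2 g : A, is_top_piece alpha f g & fin_dim_quotient (jacob g).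

(* The 1-form [P dx + Q dy] is the row vector [(P, Q)] of the free module
   [k[x,y]^2], and the 2-form [P dx /\ dy] is the polynomial [P]. *)
Definition form1 : lmodType A := 'rV[A]_2.
Definition form2 : Type := A.

Definition dx : form1 := delta_mx 0 0 : 'rV[A]_2.
Definition dy : form1 := delta_mx 0 1 : 'rV[A]_2.

Definition diff1 (f : A) : form1 := (\row_i f^`M(i)) : 'rV[A]_2.

Definition wedge (w v : 'rV[A]_2) : form2 := w 0 0 * v 0 1 - w 0 1 * v 0 0.

Definition Emod (f : A) : set form1 :=
  [set w | exists alpha : form2, wedge (diff1 f) w = f * alpha].

Definition submodule_gen (V : lmodType A) (s : seq V) : set V :=
  [set v | exists c : 'I_(size s) -> A, v = \sum_i c i *: s`_i].

End Algebra.

(* The complex numbers over [R], as a structure: the norm topology is found on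
   the carrier of a [numFieldType], but not on the bare type [R[i]]. *)
Definition Cplx (R : realType) : numClosedFieldType := R[i].

Section Germs.
Variable R : realType.
Local Notation C := (Cplx R).

Definition mono_at (m : 'X_{1..2}) (z : 'rV[C]_2) : C :=
  \prod_(i < 2) z 0 i ^+ m i.

(* Holomorphic functions of two variables are functions given near each point
   by an absolutely convergent power series; a germ in O_{C^2,0} is represented
   by a function on C^2, of which only the values near the origin matter. *)
Definition holomorphic_at0 (F : 'rV[C]_2 -> C) : Prop :=
  exists c : 'X_{1..2} -> C, \forall z \near (0 : 'rV[C]_2),
    cvgn (fun d => \sum_(m : 'X_{1..2 < d}) `|c m * mono_at m z|) /\
    (fun d => \sum_(m : 'X_{1..2 < d}) c m * mono_at m z) @ \oo --> F z.

Definition holomorphic_map_at0 (phi : 'rV[C]_2 -> 'rV[C]_2) : Prop :=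
  forall i, holomorphic_at0 (fun z => phi z 0 i).

Definition coordinate_change (phi : 'rV[C]_2 -> 'rV[C]_2) : Prop :=
  [/\ holomorphic_map_at0 phi, phi 0 = 0
    & exists psi : 'rV[C]_2 -> 'rV[C]_2,
      [/\ holomorphic_map_at0 psi, psi 0 = 0,
          \forall z \near (0 : 'rV[C]_2), psi (phi z) = z
        & \forall z \near (0 : 'rV[C]_2), phi (psi z) = z]].

Definition eval (f : {mpoly C[2]}) (z : 'rV[C]_2) : C := f.@[fun i => z 0 i].

Definition quasi_homogeneous (h : 'rV[C]_2 -> C) : Prop :=
  exists phi a (alpha : 'I_2 -> nat) (d : nat) (g : {mpoly C[2]}),
    [/\ coordinate_change phi,
        holomorphic_at0 a /\ a 0 != 0,
        pos_weights alpha,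
        g \is d.-homog for (wdeg alpha)
      & \forall z \near (0 : 'rV[C]_2), h (phi z) = a z * eval g z].

(* The subfield [k] of [C] is given with its embedding [iota]. *)
Variables (k : fieldType) (iota : {rmorphism k -> C}).

Definition evalC (f : {mpoly k[2]}) (p : 'rV[C]_2) : C :=
  eval (map_mpoly iota f) p.

Definition singular_point (f : {mpoly k[2]}) (p : 'rV[C]_2) : Prop :=
  [/\ evalC f p = 0, evalC f^`M(0) p = 0 & evalC f^`M(1) p = 0].

Definition quasi_homogeneous_at (f : {mpoly k[2]}) (p : 'rV[C]_2) : Prop :=
  quasi_homogeneous (fun z => evalC f (p + z)).

End Germs.

(* Main.v *)
Require Import Defs.
From HB Require Import structures.
From mathcomp Require Import all_boot all_order all_algebra.
From mathcomp Require Import mpoly.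
From mathcomp Require Import boolp classical_sets functions reals topology.
From mathcomp Require Import normedtype sequences complex.
From mathcomp Require Import ssrcomplements.
From mathcomp Require Import ring zify.
Import Defs.

Set Implicit Arguments.
Unset Strict Implicit.
Unset Printing Implicit Defensive.

Import Order.TTheory GRing.Theory Num.Theory.
Import numFieldNormedType.Exports.

Local Open Scope classical_set_scope.
Local Open Scope ring_scope.
Local Open Scope complex_scope.

(** Let A = k[x, y] and J = (f_x, f_y).  Sending w in E_f to the polynomial t
with df /\ w = f t maps f dx, f dy, df to - f_y, f_x, 0.  Tameness makes A / J
finite-dimensional, so f_x, f_y is a regular sequence and only the multiples
of df are sent to 0.  Hence E_f modulo f dx, f dy, df is (J : f) / J, the
annihilator of f in A / J, and the claim is that this annihilator is a
principal ideal.

The ring A / J is a product of local rings, one for each critical point of f.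
At a critical point off the curve f = 0, f is a unit.  At a singular point of
the curve, quasi-homogeneity puts the germ of f in its own Jacobian ideal, so
f becomes 0 in the local ring.  Thus f and f^2 generate the same ideal of
A / J: f = a f_x + b f_y + c f^2, the annihilator of f is generated by 1 - c f,
and w_f = a dy - b dx does the job, as df /\ w_f = f (1 - c f)
([Emod_generated]).

[top_piece_fin_dim] deduces that A / J is finite-dimensional from the same
fact for the top piece.  It is used only through a nonzero polynomial in x
alone and one in y alone that lie in J ([fin_dim_quotient_upoly]); these give
the syzygies of f_x, f_y ([jacob_syzygy]), and over the complex numbers they
reduce f = a f_x + b f_y + c f^2 to the singular points ([mem_square_ideal]).
There f is compared with its Jacobian ideal to every finite order by applying
the Euler field to the normal form of the germ ([quasi_homogeneous_jet]).  The
identity descends from the complex numbers to k by linear algebra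
([map_mpoly_ideal]). *)

(** * Univariate polynomials in the Jacobian ideal *)
Lemma ord2P (i : 'I_2) : i = 0 \/ i = 1.
Proof. by case: i => [[|[|//]] ?]; [left | right]; apply/val_inj. Qed.

Lemma ord2_lift : lift ord0 ord0 = 1 :> 'I_2.
Proof. exact/val_inj. Qed.

Lemma ord2_0 : ord0 = 0 :> 'I_2.
Proof. exact/val_inj. Qed.

Section Ideal.
Variables (k : fieldType).
Local Notation A := {mpoly k[2]}.
Implicit Types (f g p q : A).

Lemma jacob0 g : jacob g 0.
Proof. by exists 0, 0; ring. Qed.

Lemma jacobD g p q : jacob g p -> jacob g q -> jacob g (p + q).
Proof. by case=> a [b ->] [a' [b' ->]]; exists (a + a'), (b + b'); ring. Qed.

Lemma jacobMl g p q : jacob g q -> jacob g (p * q).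
Proof. by case=> a [b ->]; exists (p * a), (p * b); ring. Qed.

Lemma jacobZ g c p : jacob g p -> jacob g (c *: p).
Proof. by rewrite -mul_mpolyC; apply: jacobMl. Qed.

Lemma jacob_sum g (I : finType) (F : I -> A) :
  (forall i, jacob g (F i)) -> jacob g (\sum_i F i).
Proof. by move=> JF; elim/big_ind: _ => //; [apply: jacob0 | apply: jacobD]. Qed.

Definition upoly_at (i : 'I_2) (chi : {poly k}) : A :=
  (map_poly (@mpolyC 2 k) chi).['X_i].

Lemma upoly_atE i chi : upoly_at i chi = \sum_(j < size chi) chi`_j *: 'X_i ^+ j.
Proof.
rewrite /upoly_at horner_coef size_map_inj_poly ?mpolyC0 //; last first.
  exact: can_inj (@mpolyCK 2 k).
by apply: eq_bigr => j _; rewrite coef_map_id0 ?mpolyC0 // mul_mpolyC.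
Qed.

Lemma upoly_at_supp i chi m :
  m \in msupp (upoly_at i chi) -> exists n, m = (U_(i) *+ n)%MM.
Proof.
rewrite upoly_atE => /msupp_sum_le /flatten_mapP [j _] /msuppZ_le.
by rewrite mpolyXn => /mem_msuppXP <-; exists j.
Qed.

Lemma upoly_at_neq0 i chi : chi != 0 -> upoly_at i chi != 0.
Proof.
move=> nz; apply: contraNneq nz => E; apply/eqP/polyP => j; rewrite coef0.
case: (ltnP j (size chi)) => [lt|]; last by move=> ?; rewrite nth_default.
have := congr1 (mcoeff (U_(i) *+ j)%MM) E.
rewrite upoly_atE raddf_sum /= mcoeff0 (bigD1 (Ordinal lt)) //=.
rewrite mcoeffZ mpolyXn mcoeffX eqxx mulr1 big1 ?addr0 // => l neq.
rewrite mcoeffZ mpolyXn mcoeffX.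
case: eqP => [/(congr1 (fun m : 'X_{1..2} => m i))|]; rewrite ?mulr0 //.
rewrite !mulmnE mnm1E eqxx !mul1n => /= eqlj.
by case/eqP: neq; apply/val_inj.
Qed.

(** Pigeonhole: n + 1 powers of X_i are linearly dependent modulo an ideal
whose quotient is spanned by n elements. *)
Lemma fin_dim_quotient_upoly g i :
  fin_dim_quotient (jacob g) ->
  exists2 chi, chi != 0 & jacob g (upoly_at i chi).
Proof.
case=> n [b fin].
have [c cP] : {c : 'I_n.+1 -> 'I_n -> k &
    forall j : 'I_n.+1, jacob g ('X_i ^+ j - \sum_l c j l *: b l)}.
  exists (fun j : 'I_n.+1 => projT1 (cid (fin ('X_i ^+ j)))) => j.
  by case: cid.
pose M := \matrix_(j < n.+1, l < n) c j l.
have : kermx M != 0.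
  by rewrite kermx_eq0 -row_leq_rank -ltnNge ltnS rank_leq_col.
case/rowV0Pn => u /sub_kermxP uM0 u_neq0.
exists (rVpoly u).
  by apply: contraNneq u_neq0 => E; rewrite -[u]rVpolyK E linear0.
have -> : upoly_at i (rVpoly u) =
    \sum_(j < n.+1) u 0 j *: ('X_i ^+ j - \sum_l c j l *: b l).
  under [RHS]eq_bigr do rewrite scalerBr scaler_sumr.
  rewrite sumrB exchange_big /= [X in _ - X]big1 => [|l _]; last first.
    under eq_bigr do rewrite scalerA.
    rewrite -scaler_suml; have := congr1 (fun v : 'rV_n => v 0 l) uM0.
    rewrite !mxE (eq_bigr (fun j => u 0 j * c j l)) => [->|j _].
      by rewrite scale0r.
    by rewrite mxE.
  rewrite subr0 /upoly_at (@horner_coef_wide _ n.+1); last first.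
    rewrite size_map_inj_poly ?mpolyC0 ?size_poly //.
    exact: can_inj (@mpolyCK 2 k).
  apply: eq_bigr => j _; rewrite coef_map_id0 ?mpolyC0 // mul_mpolyC.
  by rewrite coef_rVpoly_ord.
by apply: jacob_sum => j; apply: jacobZ.
Qed.

End Ideal.

(** * From the top piece to the whole polynomial *)

Lemma mcoeff_pihomog n (R : nzRingType) (mf : measure n) d (p : {mpoly R[n]}) m :
  (pihomog mf d p)@_m = if mf m == d then p@_m else 0.
Proof.
elim/mpolyind: p => [|c m' p _ _ IH]; first by rewrite linear0 mcoeff0 if_same.
rewrite linearP /= pihomogX mcoeffD IH mcoeffZ [in RHS]mcoeffD mcoeffZ mcoeffX.
case: (eqVneq m' m) => [->|ne].
  by case: eqP; rewrite ?mcoeffX ?mcoeff0 ?eqxx ?mulr0 ?addr0.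
have -> : (if mf m' == d then 'X_[m'] else 0 : {mpoly R[n]})@_m = 0.
  by case: ifP; rewrite ?mcoeff0 // mcoeffX (negbTE ne).
by rewrite !mulr0 !add0r.
Qed.

Section Graded.
Variables (k : fieldType) (alpha : 'I_2 -> nat).
Hypothesis alpha_gt0 : pos_weights alpha.
Local Notation A := {mpoly k[2]}.
Implicit Types (f g p q r : A) (m : 'X_{1..2}).

Lemma mcoeff_wpihomog n p m :
  (pihomog (wdeg alpha) n p)@_m = if wdeg alpha m == n then p@_m else 0.
Proof. exact: mcoeff_pihomog. Qed.

Lemma mdeg_le_wdeg m : (mdeg m <= wdeg alpha m)%N.
Proof. by rewrite mdegE; apply: leq_sum => i _; rewrite leq_pmull. Qed.

(** The filtration by weighted degree, stated on coefficients so that 0 lies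
in every step of it. *)
Definition wlt n p := forall m, (n <= wdeg alpha m)%N -> p@_m = 0.

Lemma wltD n p q : wlt n p -> wlt n q -> wlt n (p + q).
Proof. by move=> P Q m ?; rewrite mcoeffD P ?Q ?addr0. Qed.

Lemma wltZ n c p : wlt n p -> wlt n (c *: p).
Proof. by move=> P m ?; rewrite mcoeffZ P ?mulr0. Qed.

Lemma wlt_mmeasure p : wlt (mmeasure (wdeg alpha) p) p.
Proof. by move=> m /mmeasure_mnm_ge; rewrite mcoeff_msupp negbK => /eqP. Qed.

Lemma mcoeffXM p m m' :
  ('X_[m] * p)@_m' = if (m <= m')%MM then p@_(m' - m)%MM else 0.
Proof.
case: ifP => [le|nle]; first by rewrite mulrC -{1}(submK le) addmC mcoeffMX.
apply/memN_msupp_eq0/negP; rewrite mulrC (perm_mem (msuppMX p m)).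
by case/mapP => m2 _ E; move: nle; rewrite E lem_addr.
Qed.

Lemma wdegU i : wdeg alpha U_(i)%MM = alpha i.
Proof.
rewrite /wdeg (bigD1 i) //= mnm1E eqxx muln1 big1 ?addn0 // => j ne.
by rewrite mnm1E eq_sym (negbTE ne) muln0.
Qed.

Variables (f g : A).

(** The derivative of g is homogeneous, so only the monomials m of a with
wdeg m + d = n + alpha i contribute to degree n; for these, 'X_[m] times the
derivative of g is the leading part of 'X_[m] times the derivative of f. *)
Lemma top_piece_mulderiv d i n a :
  g = pihomog (wdeg alpha) d f -> wlt d.+1 f ->
  exists a', wlt n (pihomog (wdeg alpha) n (a * g^`M(i)) - a' * f^`M(i)).
Proof.
move=> gE f_lt; elim/mpolyind: a => [|c m p _ _ [a' IH]].
  by exists 0; rewrite !mul0r linear0 subr0 => m _; rewrite mcoeff0.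
suff [b bP] : exists b,
    wlt n (pihomog (wdeg alpha) n ('X_[m] * g^`M(i)) - b * f^`M(i)).
  exists (c *: b + a'); rewrite !mulrDl -!scalerAl linearP /= opprD addrACA.
  by rewrite -scalerBr; apply: wltD => //; apply: wltZ.
have derivE q m' : ('X_[m] * q^`M(i))@_m' = 0 \/
    exists2 m1, m' = (m + m1)%MM &
      ('X_[m] * q^`M(i))@_m' = q@_(m1 + U_(i)) *+ (m1 i).+1.
  rewrite mcoeffXM; case: ifP => le; last by left.
  right; exists (m' - m)%MM; first by rewrite addmC submK.
  by rewrite mcoeff_deriv.
case: (eqVneq (wdeg alpha m + d)%N (n + alpha i)%N) => [E|nE].
  exists 'X_[m] => m' n_le; rewrite mcoeffB mcoeff_wpihomog.
  case: eqP => [E'|/eqP nE'].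
    rewrite !mcoeffXM; case: ifP => // le; last by rewrite subr0.
    have m'E : m' = (m + (m' - m))%MM by rewrite addmC submK.
    rewrite !mcoeff_deriv gE mcoeff_wpihomog wdegD wdegU.
    rewrite ifT ?subrr //; apply/eqP.
    by move: E'; rewrite {1}m'E wdegD; lia.
  rewrite sub0r; case: (derivE f m') => [->|[m1 m'E ->]]; first by rewrite oppr0.
  rewrite f_lt ?mul0rn ?oppr0 // wdegD wdegU.
  by move: n_le nE'; rewrite m'E wdegD; lia.
exists 0; rewrite mul0r subr0 => m' _; rewrite mcoeff_wpihomog.
case: eqP => // E'; case: (derivE g m') => [->//|[m1 m'E ->]].
rewrite gE mcoeff_wpihomog wdegD wdegU ifN ?mul0rn //.
by apply/eqP=> ?; case/eqP: nE; move: E'; rewrite m'E wdegD; lia.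
Qed.

(** The part of degree N of p lies in the Jacobian ideal of g as soon as N
exceeds the degrees of the polynomials spanning the quotient; replacing the
derivatives of g by those of f then lowers the degree of p.  What remains has
bounded degree, and positive weights leave finitely many monomials. *)
Lemma top_piece_fin_dim :
  is_top_piece alpha f g -> fin_dim_quotient (jacob g) ->
  fin_dim_quotient (jacob f).
Proof.
case=> d [gE _ top] [n [b fin]].
have f_lt : wlt d.+1 f.
  move=> m /top /(congr1 (mcoeff m)).
  by rewrite mcoeff_wpihomog eqxx mcoeff0.
pose B := (\max_i mmeasure (wdeg alpha) (b i))%N.
have red N p : wlt N p -> exists2 q, wlt B q & jacob f (p - q).
  elim: N p => [|N IH] p p_lt.
    have -> : p = 0 by apply/mpolyP => m; rewrite mcoeff0 p_lt.
    by exists 0 => [m _|]; rewrite ?mcoeff0 // subr0; apply: jacob0.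
  case: (leqP N.+1 B) => [le|BN].
    exists p; last by rewrite subrr; apply: jacob0.
    by move=> m leB; rewrite p_lt // (leq_trans le).
  have [c [a0 [a1 pE]]] := fin p.
  have [a0' lt0] := top_piece_mulderiv 0 N a0 gE f_lt.
  have [a1' lt1] := top_piece_mulderiv 1 N a1 gE f_lt.
  have top_p : pihomog (wdeg alpha) N p =
      pihomog (wdeg alpha) N (a0 * g^`M(0)) + pihomog (wdeg alpha) N (a1 * g^`M(1)).
    rewrite -linearD /= -pE linearB /= [X in _ - X](_ : _ = 0) ?subr0 //.
    apply/mpolyP => m; rewrite mcoeff0 mcoeff_wpihomog; case: eqP => // mN.
    rewrite raddf_sum big1 // => i _; apply: wltZ (leqnn _).
    move=> m'; rewrite mN => le; apply: wlt_mmeasure; apply: leq_trans le.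
    by apply: leq_trans (ltnSE BN); apply: leq_bigmax.
  have [|q q_lt jq] := IH (p - (a0' * f^`M(0) + a1' * f^`M(1))).
    rewrite -(subrKA (pihomog (wdeg alpha) N p)); apply: wltD.
      move=> m le; rewrite mcoeffB mcoeff_wpihomog; case: eqP => [|/eqP ne].
        by rewrite subrr.
      by rewrite subr0 p_lt // ltn_neqAle eq_sym ne.
    by rewrite top_p opprD addrACA; apply: wltD.
  exists q => //; rewrite -(subrK (a0' * f^`M(0) + a1' * f^`M(1)) p) addrAC.
  by apply: jacobD => //; exists a0', a1'.
pose mon (i : 'I_#|{: 'X_{1..2 < B}}|) : 'X_{1..2} := enum_val i.
exists _, (fun i => 'X_[mon i]) => p.
have [q q_lt jq] := red _ _ (@wlt_mmeasure p).
exists (fun i => q@_(mon i)).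
rewrite (_ : \sum_i _ = q) //.
have := big_enum_val (A := predT) (fun m : 'X_{1..2 < B} => q@_m *: 'X_[k, m]).
move=> /= <-; rewrite [RHS](mpolywE (k := B)) //.
rewrite msizeE; apply/bigmax_leqP_seq => m mq _.
apply: leq_ltn_trans (mdeg_le_wdeg m) _; rewrite ltnNge; apply/negP => le.
by move: mq; rewrite mcoeff_msupp q_lt ?eqxx.
Qed.

End Graded.

Lemma tame_fin_dim (k : fieldType) (f : {mpoly k[2]}) :
  tame f -> fin_dim_quotient (jacob f).
Proof.
by case=> alpha [alpha_gt0 [g top fin]]; apply: top_piece_fin_dim top fin.
Qed.

(** * Relations between the partial derivatives *)

Section Syzygy.
Variable k : fieldType.
Local Notation A := {mpoly k[2]}.
Implicit Types (f p q a b : A).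

(** Two polynomials whose leading monomials have no common variable form a
regular sequence: the leading monomial of p divides that of b, so a multiple
of p can be subtracted from b to lower it. *)
Lemma disjoint_mlead_dvd p q a b : p != 0 -> q != 0 ->
  (forall i, mlead p i = 0%N \/ mlead q i = 0%N) ->
  p * a = q * b -> exists c, b = p * c.
Proof.
move=> p0 q0 dis; elim/mleadrect: b a => b IH a E.
case: (eqVneq b 0) => [->|b0]; first by exists 0; rewrite mulr0.
have a0 : a != 0.
  apply: contraNneq b0 => a0; move/eqP: E; rewrite a0 mulr0 eq_sym.
  by rewrite mulf_eq0 (negbTE q0).
have leE : (mlead p + mlead a = mlead q + mlead b)%MM by rewrite -!mleadM // E.
have le : (mlead p <= mlead b)%MM.
  apply/mnm_lepP => i; have := congr1 (fun m : 'X_{1..2} => m i) leE.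
  by rewrite /= !mnmDE; case: (dis i) => ->; lia.
pose t : A := (mleadc b / mleadc p) *: 'X_[mlead b - mlead p].
have lcp : mleadc p != 0 by rewrite mleadc_eq0.
have lcb : mleadc b != 0 by rewrite mleadc_eq0.
have t0 : mleadc b / mleadc p != 0 by rewrite mulf_neq0 // invr_eq0.
have tn0 : t != 0 by rewrite /t mscalerI negb_or t0 -msupp_eq0 msuppX.
have leadt : mlead t = (mlead b - mlead p)%MM by rewrite mleadZ // mleadXm.
have leadpt : mlead (p * t) = mlead b.
  by rewrite mleadM // leadt addmC submK.
case: (eqVneq (b - p * t) 0) => [/subr0_eq ->|c0]; first by exists t.
have lt : (mlead (b - p * t) < mlead b)%O.
  have : (mlead (b - p * t) <= mlead b)%O.
    by rewrite (le_trans (mleadB_le _ _)) // leadpt joinxx.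
  rewrite le_eqVlt => /orP [/eqP eqm|//]; case/eqP: c0.
  apply/eqP; rewrite -mleadc_eq0 eqm mcoeffB.
  rewrite -[in X in _ - X]leadpt mleadM // mleadcM leadt mcoeffZ.
  by rewrite mcoeffX eqxx mulr1 mulrC divfK // subrr.
have [|c cE] := IH _ lt (a - q * t).
  by rewrite !mulrBr E; ring.
by exists (c + t); rewrite mulrDr -cE subrK.
Qed.

Lemma mlead_upoly_at i chi j : j != i -> mlead (@upoly_at k i chi) j = 0%N.
Proof.
move=> ne; case: (eqVneq (upoly_at i chi) 0) => [->|n0].
  by rewrite mlead0 mnm0E.
have [n ->] := upoly_at_supp (mlead_supp n0).
by rewrite mulmnE mnm1E eq_sym (negbTE ne) mul0n.
Qed.

(** With p(x) = a0 f_x + b0 f_y and T = a0 P + b0 Q, the relation gives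
p P = f_x T and p Q = f_y T.  The polynomial q(y) gives in the same way T' with
p T' = q T, so p divides T, and T / p is the common multiplier. *)
Lemma jacob_syzygy f (P Q : A) :
  (forall i, exists2 chi, chi != 0 & jacob f (upoly_at i chi)) ->
  f^`M(0) * Q = f^`M(1) * P ->
  exists c, P = c * f^`M(0) /\ Q = c * f^`M(1).
Proof.
move=> fin E.
have [chi0 n0 [a0 [b0 E0]]] := fin 0; have [chi1 n1 [a1 [b1 E1]]] := fin 1.
move: E0 E1 (upoly_at_neq0 0 n0) (upoly_at_neq0 1 n1).
have : forall i, mlead (upoly_at 0 chi0) i = 0%N \/ mlead (upoly_at 1 chi1) i = 0%N.
  move=> i; case: (eqVneq i 0) => [->|?]; last by left; apply: mlead_upoly_at.
  by right; apply: mlead_upoly_at.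
move: (upoly_at 0 chi0) (upoly_at 1 chi1) => p q dis E0 E1 p0 q0.
have [c cE] : exists c, a0 * P + b0 * Q = p * c.
  apply: (@disjoint_mlead_dvd p q (a1 * P + b1 * Q)) => //.
  by rewrite E0 E1; ring: E.
exists c; split; apply: (mulfI p0).
- by rewrite mulrA -cE E0; ring: E.
- by rewrite mulrA -cE E0; ring: E.
Qed.

End Syzygy.

(** * Descent of ideal membership along a field extension *)

Section Descent.
Variables (k K : fieldType) (iota : {rmorphism k -> K}) (n : nat).
Local Notation "p ^iota" := (map_mpoly iota p) (at level 2, format "p ^iota").

(** Membership in a row space depends only on ranks, which a field extension
does not change. *)
Lemma map_mpoly_span (T : finType) (w : T -> {mpoly k[n]}) (p : {mpoly k[n]})
    (u : T -> K) :
  p^iota = \sum_t u t *: (w t)^iota -> exists c, p = \sum_t c t *: w t.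
Proof.
move=> E; pose D := maxn (msize p) (\max_t msize (w t)).
pose W := \matrix_(i < #|T|, j < #|{: 'X_{1..n < D}}|)
  (w (enum_val i))@_(enum_val j : 'X_{1..n}).
pose v := \row_(j < #|{: 'X_{1..n < D}}|) p@_(enum_val j : 'X_{1..n}).
have : (map_mx iota v <= map_mx iota W)%MS.
  apply/submxP; exists (\row_i u (enum_val i)); apply/rowP => j; rewrite !mxE.
  have := congr1 (mcoeff (enum_val j : 'X_{1..n})) E.
  rewrite mcoeff_map_mpoly => ->; rewrite raddf_sum /=.
  have := big_enum_val (A := predT)
    (fun t => (u t *: (w t)^iota)@_(enum_val j : 'X_{1..n})).
  move=> /= ->; apply: eq_bigr => i _.
  by rewrite mcoeffZ mcoeff_map_mpoly !mxE.
rewrite map_submx => /submxP [x vE].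
exists (fun t => x 0 (enum_rank t)); apply/mpolyP => m.
case: (ltnP (mdeg m) D) => [lt|ge]; last first.
  have hi (q : {mpoly k[n]}) : (msize q <= D)%N -> q@_m = 0.
    by move=> /leq_trans /(_ ge) /msize_mdeg_ge; rewrite mcoeff_msupp negbK => /eqP.
  rewrite hi ?leq_maxl // raddf_sum big1 //= => t _.
  rewrite mcoeffZ hi ?mulr0 // leq_max; apply/orP; right; exact: leq_bigmax.
have := congr1 (fun r : 'rV_ _ => r 0 (enum_rank (BMultinom lt))) vE.
rewrite !mxE enum_rankK /= => ->; rewrite raddf_sum /=.
have := big_enum_val (A := predT)
  (fun t => (x 0 (enum_rank t) *: w t)@_m).
move=> /= ->; apply: eq_bigr => i _.
by rewrite mcoeffZ !mxE enum_valK enum_rankK.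
Qed.

(** The given multipliers have degree less than some N, so only the products
of the generators by the finitely many monomials of degree less than N are
involved. *)
Lemma map_mpoly_ideal r (q : 'I_r -> {mpoly k[n]}) (p : {mpoly k[n]})
    (a : 'I_r -> {mpoly K[n]}) :
  p^iota = \sum_j a j * (q j)^iota -> exists c, p = \sum_j c j * q j.
Proof.
move=> E; pose N := (\max_j msize (a j))%N.
have [|c cE] := @map_mpoly_span ('I_r * 'X_{1..n < N})%type
  (fun t => 'X_[t.2] * q t.1) p (fun t => (a t.1)@_(t.2)).
  rewrite E -(pair_bigA _ (fun j (m : 'X_{1..n < N}) =>
    (a j)@_m *: ('X_[m] * q j)^iota)) /=; apply: eq_bigr => j _.
  rewrite [in LHS](@mpolywE _ _ N (a j)) ?leq_bigmax // mulr_suml.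
  by apply: eq_bigr => m _; rewrite rmorphM /= map_mpolyX scalerAl.
exists (fun j => \sum_(m : 'X_{1..n < N}) c (j, m) *: 'X_[m]).
rewrite cE (eq_bigr (fun t => c (t.1, t.2) *: ('X_[t.2] * q t.1))); last first.
  by case.
rewrite -(pair_bigA _ (fun j (m : 'X_{1..n < N}) =>
    c (j, m) *: ('X_[m] * q j))) /=; apply: eq_bigr => j _.
by rewrite mulr_suml; apply: eq_bigr => m _; rewrite scalerAl.
Qed.

Lemma map_mpoly_ideal3 (q0 q1 q2 p : {mpoly k[n]}) (a0 a1 a2 : {mpoly K[n]}) :
  p^iota = a0 * q0^iota + a1 * q1^iota + a2 * q2^iota ->
  exists c0 c1 c2, p = c0 * q0 + c1 * q1 + c2 * q2.
Proof.
move=> E; pose q (j : 'I_3) := tnth [tuple q0; q1; q2] j.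
have [|c cE] := @map_mpoly_ideal 3 q p (fun j => tnth [tuple a0; a1; a2] j).
  by rewrite E !big_ord_recl big_ord0 /q !(tnth_nth 0) /= addr0 addrA.
exists (c ord0), (c (lift ord0 ord0)), (c (lift ord0 (lift ord0 ord0))).
by rewrite [LHS]cE !big_ord_recl big_ord0 /q !(tnth_nth 0) /= addr0 addrA.
Qed.

End Descent.

(** * Ideals of finite codimension over an algebraically closed field *)

Lemma mpoly_ring_ind n (R : nzRingType) (P : {mpoly R[n]} -> Prop) :
  (forall c, P c%:MP) -> (forall i, P 'X_i) ->
  (forall p q, P p -> P q -> P (p + q)) ->
  (forall p q, P p -> P q -> P (p * q)) -> forall p, P p.
Proof.
move=> PC PX PD PM; elim/mpolyind => [|c m p _ _ Pp]; first by rewrite -mpolyC0.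
apply: PD => //; rewrite -mul_mpolyC; apply: (PM) => //.
rewrite mpolyXE_id; elim/big_ind: _ => // [|i _]; first by rewrite -mpolyC1.
by elim: (m i) => [|l IH]; rewrite ?expr0 -?mpolyC1 // exprS; apply: PM.
Qed.

Section UpolyMorphism.
Variables (k : fieldType) (i : 'I_2).

Lemma upoly_atM (p q : {poly k}) :
  upoly_at i (p * q) = upoly_at i p * upoly_at i q.
Proof. by rewrite /upoly_at rmorphM hornerM. Qed.

Lemma upoly_atXsubC (c : k) : upoly_at i ('X - c%:P) = 'X_i - c%:MP.
Proof. by rewrite /upoly_at map_polyXsubC !hornerE. Qed.

Lemma upoly_atX (p : {poly k}) n : upoly_at i (p ^+ n) = upoly_at i p ^+ n.
Proof. by rewrite /upoly_at rmorphXn horner_exp. Qed.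

Lemma meval_upoly_at (v : 'I_2 -> k) (p : {poly k}) :
  (upoly_at i p).@[v] = p.[v i].
Proof.
rewrite upoly_atE raddf_sum /= horner_coef; apply: eq_bigr => j _.
by rewrite mevalZ rmorphXn /= mevalXU.
Qed.

End UpolyMorphism.

Section Nullstellensatz.
Variable K : closedFieldType.
Local Notation A := {mpoly K[2]}.
Implicit Types (I : set A) (p q f : A) (v : 'I_2 -> K).

Definition ideal I := (forall p q, I p -> I q -> I (p + q)) /\
  (forall p q, I q -> I (p * q)).

Lemma jacob_ideal f : ideal (jacob f).
Proof. by split; [apply: jacobD | apply: jacobMl]. Qed.

Definition adjoin I q : set A := [set p | exists a, I (p - a * q)].

Lemma adjoin_ideal I q : ideal I -> ideal (adjoin I q).
Proof.
case=> ID IM; split=> [p p' [a Ia] [a' Ia']|p p' [a Ia]].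
  exists (a + a'); rewrite (_ : _ - _ = (p - a * q) + (p' - a' * q)); first exact: ID.
  by ring.
exists (p * a); rewrite (_ : _ - _ = p * (p' - a * q)); first exact: IM.
by ring.
Qed.

Lemma sub_adjoin I q p : I p -> adjoin I q p.
Proof. by exists 0; rewrite mul0r subr0. Qed.

Lemma mem_adjoin I q p : ideal I -> I p -> adjoin I q q.
Proof.
move=> [_ IM] Ip; exists 1; rewrite mul1r subrr -(mul0r p); exact: IM.
Qed.

(** If 1 were in I + ('X_i - c) for every root c of chi, the linear factors
could be stripped from chi('X_i) one by one, down to 1 in I. *)
Lemma adjoin_root_proper I i chi : ideal I -> ~ I 1 -> chi != 0 ->
  I (upoly_at i chi) -> exists c, ~ adjoin I ('X_i - c%:MP) 1.
Proof.
move=> [ID IM] I1 chi0; have [r ->] := closed_field_poly_normal chi.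
rewrite /upoly_at map_polyZ hornerZ => /(IM (lead_coef chi)^-1%:MP).
rewrite mulrA -mpolyCM mulVf ?lead_coef_eq0 // mul1r -/(upoly_at _ _).
elim: r => [|c r IH].
  by rewrite big_nil /upoly_at rmorph1 hornerC.
rewrite big_cons upoly_atM upoly_atXsubC => Icr.
have [[a Ia]|] := pselect (adjoin I ('X_i - c%:MP) 1); last by exists c.
apply: IH; set t := upoly_at _ _ in Icr *.
rewrite (_ : t = t * (1 - a * ('X_i - c%:MP)) + a * (('X_i - c%:MP) * t)).
  by apply: ID; apply: IM.
by ring.
Qed.

Lemma ideal_mevalB I v : ideal I -> (forall i, I ('X_i - (v i)%:MP)) ->
  forall p, I (p - p.@[v]%:MP).
Proof.
move=> [ID IM] IX; have I0 : I 0 by rewrite -(mul0r ('X_0 - (v 0)%:MP)); apply: IM.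
apply: mpoly_ring_ind => [c|i|p q Ip Iq|p q Ip Iq].
- by rewrite mevalC subrr.
- by rewrite mevalXU; apply: IX.
- by rewrite mevalD mpolyCD opprD addrACA; apply: ID.
- rewrite mevalM mpolyCM.
  rewrite (_ : _ - _ = q * (p - p.@[v]%:MP) + p.@[v]%:MP * (q - q.@[v]%:MP)).
    by apply: ID; apply: IM.
  by ring.
Qed.

(** The weak Nullstellensatz for ideals that contain a nonzero polynomial in
each variable: the ideal stays proper after adjoining 'X_i - c_i for suitable
roots c_i, and modulo these every polynomial is its value at (c_0, c_1). *)
Lemma ideal_common_zero I : ideal I -> ~ I 1 ->
  (forall i, exists2 chi, chi != 0 & I (upoly_at i chi)) ->
  exists v, forall p, I p -> p.@[v] = 0.
Proof.
move=> idI I1 fin; have [chi0 n0 J0] := fin 0; have [chi1 n1 J1] := fin 1.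
have [c0 I'1] := adjoin_root_proper idI I1 n0 J0.
set I' := adjoin _ _ in I'1; have idI' : ideal I' by apply: adjoin_ideal.
have [c1 I''1] := adjoin_root_proper idI' I'1 n1 (sub_adjoin _ J1).
set I'' := adjoin _ _ in I''1; have idI'' : ideal I'' by apply: adjoin_ideal.
pose v i := if i == 0 :> 'I_2 then c0 else c1.
have IX i : I'' ('X_i - (v i)%:MP).
  have [->|->] := ord2P i.
    by apply/sub_adjoin/(mem_adjoin _ idI J0).
  by apply: (mem_adjoin _ idI' (sub_adjoin _ J1)).
exists v => p Ip; apply/eqP/negP => /negP pv; case: I''1.
have [ID IM] := idI''.
have Ic : I'' (p.@[v]%:MP).
  rewrite (_ : _%:MP = p + (-1) * (p - p.@[v]%:MP)); last by ring.
  apply: ID; first by do 2!apply: sub_adjoin.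
  by apply: IM; apply: ideal_mevalB.
have -> : (1 : A) = (p.@[v])^-1%:MP * p.@[v]%:MP by rewrite -mpolyCM mulVf.
exact: IM.
Qed.

(** In the local ring at v, some power of the maximal ideal lies in I; s
collects the factors of the two univariate polynomials that do not vanish
at v. *)
Lemma local_unit I v : ideal I ->
  (forall i, exists2 chi, chi != 0 & I (upoly_at i chi)) ->
  exists s n, s.@[v] != 0 /\ forall i, I (s * ('X_i - (v i)%:MP) ^+ n).
Proof.
move=> [ID IM] fin.
have loc i : exists s n, s.@[v] != 0 /\ I (s * ('X_i - (v i)%:MP) ^+ n).
  have [chi n0 Ichi] := fin i.
  have [n [q]] := multiplicity_XsubC chi (v i); rewrite n0 /= => rq chiE.
  exists (upoly_at i q), n; rewrite meval_upoly_at; split=> //.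
  by rewrite -upoly_atXsubC -upoly_atX -upoly_atM -chiE.
have [s0 [m0 [v0 I0]]] := loc 0; have [s1 [m1 [v1 I1]]] := loc 1.
exists (s0 * s1), (m0 + m1)%N; rewrite mevalM mulf_neq0 //; split=> // i.
have [->|->] := ord2P i.
  rewrite exprD (_ : _ * _ = s1 * ('X_0 - (v 0)%:MP) ^+ m1 *
    (s0 * ('X_0 - (v 0)%:MP) ^+ m0)); first exact: IM.
  by ring.
rewrite exprD (_ : _ * _ = s0 * ('X_1 - (v 1)%:MP) ^+ m0 *
  (s1 * ('X_1 - (v 1)%:MP) ^+ m1)); first exact: IM.
by ring.
Qed.

(** It suffices that 1 lies in (J : f) + (f).  Otherwise this ideal has a
common zero v, at which f, f_x and f_y vanish.  There the local hypothesis and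
[local_unit] give s in (J : f) with s(v) <> 0, a contradiction. *)
Lemma mem_square_ideal f :
  (forall i, exists2 chi, chi != 0 & jacob f (upoly_at i chi)) ->
  (forall v, f.@[v] = 0 -> f^`M(0).@[v] = 0 -> f^`M(1).@[v] = 0 ->
    forall n, exists b0 b1 r0 r1, f = b0 * f^`M(0) + b1 * f^`M(1) +
      (r0 * ('X_0 - (v 0)%:MP) ^+ n + r1 * ('X_1 - (v 1)%:MP) ^+ n)) ->
  exists a b c, f = a * f^`M(0) + b * f^`M(1) + c * f ^+ 2.
Proof.
move=> fin loc; have [JD JM] := jacob_ideal f.
pose I : set A := [set p | exists s h, jacob f (s * f) /\ p = s + h * f].
have idI : ideal I.
  split=> [_ _ [s [h [Js ->]]] [s' [h' [Js' ->]]]|p _ [s [h [Js ->]]]].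
    exists (s + s'), (h + h'); split; last by ring.
    by rewrite mulrDl; apply: JD.
  exists (p * s), (p * h); split; last by ring.
  by rewrite -mulrA; apply: JM.
have JI p : jacob f p -> I p.
  by move=> Jp; exists p, 0; split; [rewrite mulrC; apply: JM | ring].
have [[s [h [[a [b E]] E1]]]|I1] := pselect (I 1).
  exists a, b, h; rewrite -E (_ : s = 1 - h * f); first by ring.
  by rewrite E1; ring.
have [|v zero] := ideal_common_zero idI I1.
  by move=> i; have [chi n0 Jchi] := fin i; exists chi => //; apply: JI.
have [s [n [sv0 Js]]] := local_unit v (jacob_ideal f) fin.
have [|||b0 [b1 [r0 [r1 fE]]]] := loc v _ _ _ n.
- by apply: zero; exists 0, 1; rewrite mul0r add0r mul1r; split=> //; apply: jacob0.
- by apply/zero/JI; exists 1, 0; ring.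
- by apply/zero/JI; exists 0, 1; ring.
case/eqP: sv0; apply: zero; exists s, 0; split; last by ring.
rewrite [X in s * X]fE (_ : s * _ = (s * b0 * f^`M(0) + s * b1 * f^`M(1)) +
  (r0 * (s * ('X_0 - (v 0)%:MP) ^+ n) + r1 * (s * ('X_1 - (v 1)%:MP) ^+ n))).
  by apply: (JD); [exists (s * b0), (s * b1) | apply: JD; apply: JM].
by ring.
Qed.

End Nullstellensatz.

(** * Order of vanishing of functions at the origin *)

Section BigO.
Variable R : realType.
Local Notation C := (Cplx R).
Local Notation C2 := 'rV[C]_2.
Implicit Types (F G : C2 -> C) (p q : {mpoly C[2]}) (phi psi : C2 -> C2).

(** Jets of germs are compared through their growth at the origin: a germ can
then be substituted into another without formal power series, and
[bigO_mord] turns growth back into a condition on coefficients. *)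
Definition bigO (N : nat) F :=
  exists2 M : C, 0 <= M & \forall z \near (0 : C2), `|F z| <= M * `|z| ^+ N.

Lemma eq_bigO N F G : (\forall z \near (0 : C2), F z = G z) -> bigO N F -> bigO N G.
Proof.
move=> E [M M0 HF]; exists M => //; near=> z.
by rewrite -(near E z) //; near: z.
Unshelve. all: by end_near. Qed.

Lemma ext_bigO N F G : F =1 G -> bigO N F -> bigO N G.
Proof. by move=> /funext ->. Qed.

Lemma bigOD N F G : bigO N F -> bigO N G -> bigO N (fun z => F z + G z).
Proof.
move=> [M M0 HF] [M' M'0 HG]; exists (M + M'); first exact: addr_ge0.
near=> z; rewrite mulrDl (le_trans (ler_normD _ _)) // lerD //; near: z.
  exact: HF.
exact: HG.
Unshelve. all: by end_near. Qed.

Lemma bigOM N N' F G : bigO N F -> bigO N' G -> bigO (N + N') (fun z => F z * G z).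
Proof.
move=> [M M0 HF] [M' M'0 HG]; exists (M * M'); first exact: mulr_ge0.
near=> z; rewrite normrM exprD mulrACA ler_pM //; near: z.
  exact: HF.
exact: HG.
Unshelve. all: by end_near. Qed.

Lemma bigO_leq N N' F : (N' <= N)%N -> bigO N F -> bigO N' F.
Proof.
move=> le [M M0 HF]; exists M => //; near=> z.
have z1 : `|z| <= 1 by near: z; exact: (@nbhs0_le _ C2 1 ltr01).
apply: le_trans (_ : M * `|z| ^+ N <= _); first by near: z.
by rewrite ler_wpM2l // ler_wiXn2l.
Unshelve. all: by end_near. Qed.

Lemma bigO_cst c : bigO 0 (fun=> c).
Proof.
by exists `|c| => //; near=> z; rewrite expr0 mulr1.
Unshelve. all: by end_near. Qed.

Lemma coord_le_norm (z : C2) i : `|z 0 i| <= `|z|.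
Proof.
apply/ler_addgt0Pr => e e0; apply: ltW.
have : ball_ (fun x : C2 => `|x|) 0 (`|z| + e) z.
  by rewrite /ball_ /= sub0r normrN ltrDl.
rewrite -mx_norm_ball => -[_ /(_ 0 i)].
by rewrite -ball_normE /= mxE sub0r normrN.
Qed.

Lemma norm_le_coords (z : C2) : `|z| <= `|z 0 0| + `|z 0 1|.
Proof.
have [/eqP ->|/mx_norm_neq0 [[i j] /= E]] := boolP (`|z| == 0).
  by rewrite addr_ge0.
rewrite [leLHS]/(Num.norm _) /= E ord1.
have [->|->] := ord2P j.
  by rewrite lerDl.
by rewrite lerDr.
Qed.

Lemma bigO_coord i : bigO 1 (fun z => z 0 i).
Proof.
by exists 1 => //; near=> z; rewrite mul1r expr1 coord_le_norm.
Unshelve. all: by end_near. Qed.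

Lemma bigO0M N F G : bigO 0 F -> bigO N G -> bigO N (fun z => F z * G z).
Proof. exact: bigOM. Qed.

Lemma bigOM0 N F G : bigO N F -> bigO 0 G -> bigO N (fun z => F z * G z).
Proof. by move=> HF HG; rewrite -[N]addn0; apply: bigOM. Qed.

Lemma bigON N F : bigO N F -> bigO N (fun z => - F z).
Proof.
move=> [M M0 HF]; exists M => //; near=> z; rewrite normrN; near: z; exact: HF.
Unshelve. all: by end_near. Qed.

Lemma bigOB N F G : bigO N F -> bigO N G -> bigO N (fun z => F z - G z).
Proof. by move=> HF /bigON; apply: bigOD. Qed.

Lemma bigO_eval p : bigO 0 (eval p).
Proof.
elim/mpoly_ring_ind: p => [c|i|p q Hp Hq|p q Hp Hq].
- by apply: ext_bigO (bigO_cst c) => z; rewrite /eval mevalC.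
- by apply: ext_bigO (bigO_leq (leq0n _) (bigO_coord i)) => z; rewrite /eval mevalXU.
- by apply: ext_bigO (bigOD Hp Hq) => z; rewrite /eval mevalD.
- by apply: ext_bigO (bigOM0 Hp Hq) => z; rewrite /eval mevalM.
Qed.

Lemma bigO_eval_sub N p phi psi :
  (forall i, bigO 0 (fun z => phi z 0 i)) -> (forall i, bigO 0 (fun z => psi z 0 i)) ->
  (forall i, bigO N (fun z => phi z 0 i - psi z 0 i)) ->
  bigO 0 (fun z => eval p (phi z)) /\ bigO N (fun z => eval p (phi z) - eval p (psi z)).
Proof.
move=> b b' s; suff: [/\ bigO 0 (fun z => eval p (phi z)),
   bigO 0 (fun z => eval p (psi z)) & bigO N (fun z => eval p (phi z) - eval p (psi z))].
  by case.
(* The difference of two products telescopes with bounded factors only. *)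
elim/mpoly_ring_ind: p => [c|i|p q [p1 p2 p3] [q1 q2 q3]|p q [p1 p2 p3] [q1 q2 q3]].
- split; [| |apply: (ext_bigO (F := fun=> 0)) => [z|]].
  + by apply: (ext_bigO (F := fun=> c)) => [z|]; rewrite ?/eval ?mevalC //; apply: bigO_cst.
  + by apply: (ext_bigO (F := fun=> c)) => [z|]; rewrite ?/eval ?mevalC //; apply: bigO_cst.
  + by rewrite /eval !mevalC subrr.
  + by exists 0 => //; near=> z; rewrite mul0r normr0.
- split; [apply: ext_bigO (b i)|apply: ext_bigO (b' i)|apply: ext_bigO (s i)] => z;
    by rewrite /eval !mevalXU.
- split; [apply: ext_bigO (bigOD p1 q1)|apply: ext_bigO (bigOD p2 q2)|
    apply: ext_bigO (bigOD p3 q3)] => z; rewrite /eval !mevalD //; ring.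
- split; [apply: ext_bigO (bigOM0 p1 q1)|apply: ext_bigO (bigOM0 p2 q2)|
    apply: ext_bigO (bigOD (bigOM0 p3 q1) (bigO0M p2 q3))] => z; rewrite /eval !mevalM //; ring.
Unshelve. all: by end_near. Qed.

Lemma bigO_vec psi : (forall i, bigO 1 (fun z => psi z 0 i)) ->
  exists2 M : C, 0 <= M & \forall z \near (0 : C2), `|psi z| <= M * `|z|.
Proof.
move=> Hpsi; have [M0 M00 H0] := Hpsi 0; have [M1 M10 H1] := Hpsi 1.
exists (M0 + M1); first exact: addr_ge0.
near=> z; apply: le_trans (norm_le_coords _) _; rewrite mulrDl -{1 2}[`|z|]expr1.
by rewrite lerD //; near: z.
Unshelve. all: by end_near. Qed.

Lemma near_comp psi (P : set C2) : (forall i, bigO 1 (fun z => psi z 0 i)) ->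
  (\forall z \near (0 : C2), P z) -> \forall z \near (0 : C2), P (psi z).
Proof.
move=> /bigO_vec [M M0 H] /nbhs_norm0P [e e0 eP].
near=> z; apply: eP => /=.
apply: le_lt_trans (_ : M * `|z| < _); first by near: z.
have : `|z| < e / (M + 1).
  by near: z; apply: (@nbhs0_lt _ C2); rewrite divr_gt0 // ltr_wpDl.
rewrite ltr_pdivlMr ?ltr_wpDl // mulrC; apply: le_lt_trans.
by rewrite ler_wpM2r // lerDl.
Unshelve. all: by end_near. Qed.

Lemma bigO_comp N F psi : (forall i, bigO 1 (fun z => psi z 0 i)) ->
  bigO N F -> bigO N (F \o psi).
Proof.
move=> Hpsi [M M0 HF]; have [M' M'0 H] := bigO_vec Hpsi.
exists (M * M' ^+ N); first by rewrite mulr_ge0 // exprn_ge0.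
near=> z; apply: le_trans (_ : M * `|psi z| ^+ N <= _).
  near: z; exact: (near_comp Hpsi HF).
rewrite -mulrA -exprMn ler_wpM2l // lerXn2r // ?nnegrE ?mulr_ge0 //.
by near: z.
Unshelve. all: by end_near. Qed.

End BigO.

(** * Taylor polynomials of holomorphic germs *)

Section Taylor.
Variable R : realType.
Local Notation C := (Cplx R).
Local Notation C2 := 'rV[C]_2.
Implicit Types (F : C2 -> C) (p : {mpoly C[2]}).

Lemma mono_at_norm (m : 'X_{1..2}) (z : C2) : `|mono_at m z| <= `|z| ^+ mdeg m.
Proof.
rewrite /mono_at normr_prod mdegE -prodrXr; apply: ler_prod => i _.
by rewrite normr_ge0 normrX lerXn2r ?nnegrE // coord_le_norm.
Qed.

Lemma mono_at_diag (m : 'X_{1..2}) (r : C) :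
  mono_at m (const_mx r : C2) = r ^+ mdeg m.
Proof. by rewrite /mono_at mdegE -prodrXr; apply: eq_bigr => i _; rewrite mxE. Qed.

Definition taylor (c : 'X_{1..2} -> C) N : {mpoly C[2]} :=
  \sum_(m : 'X_{1..2 < N}) c m *: 'X_[m].

Lemma eval_taylor (c : 'X_{1..2} -> C) N (z : C2) :
  eval (taylor c N) z = \sum_(m : 'X_{1..2 < N}) c m * mono_at m z.
Proof.
rewrite /eval raddf_sum /=; apply: eq_bigr => m _.
by rewrite mevalZ mevalX.
Qed.

(** Compare with the series at the diagonal point (r, r): for |z| <= r, a
monomial of degree at least N is at z at most (|z| / r)^N times its value at
that point. *)
Lemma taylor_tail (c : 'X_{1..2} -> C) N D (z : C2) (r S : C) :
  (N <= D)%N -> 0 < r -> `|z| <= r ->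
  \sum_(m : 'X_{1..2 < D}) `|c m * mono_at m (const_mx r : C2)| <= S ->
  `|eval (taylor c D) z - eval (taylor c N) z| <= S / r ^+ N * `|z| ^+ N.
Proof.
move=> ND r0 zr leS; rewrite !eval_taylor.
have -> : \sum_(m : 'X_{1..2 < N}) c m * mono_at m z =
    \sum_(m : 'X_{1..2 < D} | (mdeg m < N)%N) c m * mono_at m z.
  apply: (@big_sub_widen _ _ _ _ (fun m => mdeg m < N)%N (fun m => mdeg m < D)%N
    'X_{1..2 < N} 'X_{1..2 < D} predT (fun m => c m * mono_at m z)).
  by move=> m /leq_trans; apply.
rewrite (bigID (fun m : 'X_{1..2 < D} => (mdeg m < N)%N)) /= addrAC subrr add0r.
apply: le_trans (ler_norm_sum _ _ _) _.
apply: le_trans (_ : \sum_(m : 'X_{1..2 < D})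
  `|c m * mono_at m (const_mx r : C2)| * (`|z| / r) ^+ N <= _).
  rewrite [leRHS](bigID (fun m : 'X_{1..2 < D} => (mdeg m < N)%N)) /=.
  rewrite -[leLHS]add0r lerD //.
    by apply: sumr_ge0 => m _; rewrite mulr_ge0 // exprn_ge0 // divr_ge0 // ltW.
  apply: ler_sum => m; rewrite -leqNgt => Nm.
  rewrite mono_at_diag !normrM -mulrA ler_wpM2l //.
  apply: le_trans (mono_at_norm _ _) _.
  rewrite normrX (gtr0_norm r0) -(subnKC Nm); set k := (mdeg m - N)%N.
  have -> : r ^+ (N + k) * (`|z| / r) ^+ N = `|z| ^+ N * r ^+ k.
    rewrite exprD exprMn exprVn; move: (expf_neq0 N (lt0r_neq0 r0)).
    by move: (r ^+ N) (r ^+ k) (`|z| ^+ N) => a b d a0; field.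
  by rewrite exprD ler_wpM2l ?exprn_ge0 // lerXn2r ?nnegrE ?(ltW r0).
rewrite -mulr_suml exprMn exprVn [X in _ <= X](_ : _ = S * (`|z| ^+ N / r ^+ N)).
  by rewrite ler_wpM2r // divr_ge0 // exprn_ge0 // ltW.
by rewrite -mulrA [_^-1 * _]mulrC.
Qed.

(** The bound on the tails does not depend on D, so it survives in the limit
D --> oo.  The radius r is half that of a ball of convergence, so that the
series converges absolutely at (r, r). *)
Lemma holomorphic_taylor F N : holomorphic_at0 F ->
  exists p, bigO N (fun z => F z - eval p z).
Proof.
case=> c /nbhs_norm0P [e e0 eP]; exists (taylor c N).
pose r := e / 2; have r0 : 0 < r by rewrite divr_gt0.
have re : r < e by rewrite ltr_pdivrMr // mulr_natr mulr2n ltrDl.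
have normw : `|const_mx r : C2| < e.
  have [->|/mx_norm_neq0 [[i j]]] := eqVneq (`|const_mx r : C2|) 0; first exact: e0.
  by rewrite /(Num.norm (_ : C2)) /= => ->; rewrite mxE gtr0_norm.
have [/cvg_ex [l cl] _] := eP _ normw.
pose S := `|l| + 1; have S0 : 0 <= S by rewrite addr_ge0.
exists (S / r ^+ N); first by rewrite divr_ge0 // exprn_ge0 // ltW.
apply/nbhs_norm0P; exists r => // z /= zr.
have [_ cF] := eP _ (lt_trans zr re).
have bnd : \forall D \near \oo,
    `| \sum_(m : 'X_{1..2 < D}) `|c m * mono_at m (const_mx r : C2)| | <= S.
  apply: (@cvgr_norm_le C C^o _ _ _ _ l cl).
  by rewrite ltrDl.
have tail : \forall D \near \oo,
    `|eval (taylor c D) z - eval (taylor c N) z| <= S / r ^+ N * `|z| ^+ N.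
  near=> D; apply: taylor_tail => //; [by near: D; exact: nbhs_infty_ge|exact: ltW|].
  apply: le_trans (_ : `| \sum_(m : 'X_{1..2 < D}) `|c m * mono_at m (const_mx r : C2)| | <= _).
    by rewrite ger0_norm // sumr_ge0.
  by near: D.
have cd : (fun D => eval (taylor c D) z - eval (taylor c N) z) @ \oo -->
    F z - eval (taylor c N) z.
  apply: cvgB; last exact: cvg_cst.
  by under eq_fun do rewrite eval_taylor.
rewrite real_leNgt ?ger0_real //; last first.
  by rewrite mulr_ge0 ?exprn_ge0 // divr_ge0 // exprn_ge0 // ltW.
apply/negP => lt0; have gt := @cvgr_norm_gt C C^o _ _ eventually_filter _ _ cd _ lt0.
have [D [le lt]] := filter_ex (filterI tail gt).
by have := lt_le_trans lt le; rewrite ltxx.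
Unshelve. all: by end_near. Qed.

End Taylor.

(** * Order of vanishing of polynomials *)

Section Order.
Variable R : realType.
Local Notation C := (Cplx R).
Local Notation C2 := 'rV[C]_2.
Implicit Types (p q : {mpoly C[2]}).

Definition mord N p := forall m, (mdeg m < N)%N -> p@_m = 0.

Lemma mord_bigO N p : mord N p -> bigO N (eval p).
Proof.
move=> ordp; apply: (ext_bigO (F := fun z =>
    \sum_(m <- msupp p) p@_m * mono_at m z)) => [z|]; first by rewrite /eval mevalE.
have : {subset msupp p <= msupp p} by [].
elim: {1 3}(msupp p) => [|m s IH] sub.
  apply: (ext_bigO (F := fun=> 0)) => [z|]; first by rewrite big_nil.
  by exists 0 => //; near=> z; rewrite mul0r normr0.
apply: (ext_bigO (F := fun z => p@_m * mono_at m z +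
    \sum_(m <- s) p@_m * mono_at m z)) => [z|]; first by rewrite big_cons.
apply: bigOD; last by apply: IH => m' m's; rewrite sub // inE m's orbT.
apply/bigO0M; first exact: bigO_cst.
apply: (@bigO_leq _ (mdeg m)).
  rewrite leqNgt; apply/negP => /ordp /eqP; apply/negP.
  by rewrite -mcoeff_msupp sub // mem_head.
by exists 1 => //; near=> z; rewrite mul1r mono_at_norm.
Unshelve. all: by end_near. Qed.

Lemma poly_eq0_everywhere (K : numFieldType) (q : {poly K}) :
  (forall x, q.[x] = 0) -> q = 0.
Proof.
move=> q0; apply/eqP/negP => /negP nz.
have /max_poly_roots -/(_ [seq i%:R | i <- iota 0 (size q)]) := nz.
rewrite size_map size_iota ltnn map_inj_uniq ?iota_uniq; last first.
  by move=> i j /eqP; rewrite eqr_nat => /eqP.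
suff -> : all (root q) [seq i%:R | i <- iota 0 (size q)] by move=> /(_ isT isT).
by apply/allP => x _; apply/eqP.
Qed.

(** Setting x = 1 gives a polynomial in y with infinitely many roots, and in a
fixed degree a monomial is determined by its exponent in y. *)
Lemma homog_eval_eq0 N q : q \is N.-homog -> (forall z : C2, eval q z = 0) -> q = 0.
Proof.
move=> /dhomogP hq q0.
pose u : {poly C} := \sum_(m <- msupp q) q@_m *: 'X^(m 1).
have u0 : u = 0.
  apply: poly_eq0_everywhere => x; rewrite -(q0 (\row_i if i == 0 then 1 else x)).
  rewrite /u horner_sum /eval mevalE; apply: eq_bigr => m _.
  rewrite !hornerE big_ord_recl big_ord1 !mxE /= expr1n mul1r.
  by congr (_ * _ ^+ m _); apply/val_inj.
apply/mpolyP => m; rewrite mcoeff0; apply: contrapT => /eqP.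
rewrite -mcoeff_msupp => mq; move: (mq); rewrite mcoeff_msupp => /eqP; apply.
have := congr1 (fun v : {poly C} => v`_(m 1)) u0.
rewrite coef0 /u coef_sum (bigD1_seq m) ?msupp_uniq //= big1_seq => [|m' /andP[ne m'q]].
  by rewrite addr0 coefZ coefXn eqxx mulr1.
rewrite coefZ coefXn; case: eqP => [E|]; last by rewrite mulr0.
have := hq _ mq; rewrite -(hq _ m'q) /= !mdegE !big_ord_recl !big_ord0 !addn0 => E'.
rewrite ord2_0 ord2_lift E in E'; case/eqP: ne; apply/mnmP => i.
have [->|->] := ord2P i; last by rewrite E.
by move: E'; lia.
Qed.

Lemma homog_scale N q (t : C) (z : C2) : q \is N.-homog ->
  eval q (t *: z) = t ^+ N * eval q z.
Proof.
move=> /dhomogP hq; rewrite /eval !mevalE mulr_sumr; apply: eq_big_seq => m mq.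
rewrite mulrCA; congr (_ * _); rewrite -(hq _ mq) /= mdegE -prodrXr -big_split /=.
by apply: eq_bigr => i _; rewrite mxE exprMn.
Qed.

(** On a line, q(t z) = t^N q(z) cannot be bounded by a multiple of t^(N+1) as
t tends to 0, unless q(z) = 0. *)
Lemma homog_bigO_eq0 N q : q \is N.-homog -> bigO N.+1 (eval q) -> q = 0.
Proof.
move=> hq [M M0 /nbhs_norm0P [e e0 eP]]; apply: (homog_eval_eq0 hq) => z.
apply/eqP; rewrite -normr_eq0; apply/negP => /negP nz.
set a := `|eval q z| in nz; have a0 : 0 < a by rewrite lt_def nz normr_ge0.
have e0' : 0 < e := e0.
pose t0 := e / (`|z| + 1).
have z1 : 0 < `|z| + 1 by rewrite ltr_wpDl.
have t00 : 0 < t0 by rewrite divr_gt0.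
pose B := M * `|z| ^+ N.+1; have B0 : 0 <= B by rewrite mulr_ge0 // exprn_ge0.
have den0 : 0 < a + t0 * B by rewrite ltr_wpDr // mulr_ge0 // ltW.
(* t0 keeps t z in the ball; the other factor makes t B smaller than a. *)
have [t [t_gt0 tz tB]] : exists t, [/\ 0 < t, t * `|z| < e & t * B < a].
  exists (t0 * (a / (a + t0 * B))); split.
  - by rewrite mulr_gt0 // divr_gt0.
  - apply: le_lt_trans (_ : t0 * `|z| < _).
      rewrite ler_wpM2r // ler_piMr ?(ltW t00) // ler_pdivrMr // mul1r lerDl.
      by rewrite mulr_ge0 // ltW.
    by rewrite /t0 mulrAC ltr_pdivrMr // ltr_pM2l // ltrDl.
  - rewrite mulrAC mulrA ltr_pdivrMr // [t0 * B * a]mulrC ltr_pM2l //.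
    by rewrite ltrDr.
have := eP (t *: z); rewrite /= normrZ (gtr0_norm t_gt0) => /(_ tz).
rewrite (homog_scale _ _ hq) normrM normrX (gtr0_norm t_gt0) exprMn -/a.
rewrite mulrCA -/B exprSr -mulrA ler_pM2l ?exprn_gt0 // => H.
by have := le_lt_trans H tB; rewrite ltxx.
Qed.

(** The homogeneous parts of degree less than N vanish one after the other,
from the lowest one on. *)
Lemma bigO_mord N p : bigO N (eval p) -> mord N p.
Proof.
elim: N => [|N IH] O; first by move=> m; rewrite ltn0.
have ordN := IH (bigO_leq (leqnSn N) O).
pose q := pihomog mdeg N p.
have ordpq : mord N.+1 (p - q).
  move=> m; rewrite ltnS leq_eqVlt mcoeffB mcoeff_pihomog.
  case: eqP => /= [_ _|_ /ordN ->]; rewrite ?subrr ?subr0 //.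
have q0 : q = 0.
  apply: (homog_bigO_eq0 (pihomogP _ _ _)).
  apply: ext_bigO (bigOB O (mord_bigO ordpq)) => z.
  by rewrite /eval mevalB; ring.
by move: ordpq; rewrite q0 subr0.
Qed.

End Order.

(** * The weighted Euler vector field *)

Section Euler.
Variables (K : fieldType) (alpha : 'I_2 -> nat).
Implicit Types (p q g h : {mpoly K[2]}).

Definition euler p : {mpoly K[2]} := \sum_i (alpha i)%:R *: ('X_i * p^`M(i)).

(** The Euler field is diagonal on monomials; hence it preserves the order of
vanishing and multiplies a weighted homogeneous polynomial by its degree. *)
Lemma mcoeff_euler p m : (euler p)@_m = (wdeg alpha m)%:R * p@_m.
Proof.
rewrite /euler raddf_sum /wdeg natr_sum mulr_suml; apply: eq_bigr => i _ /=.
rewrite mcoeffZ mcoeffXM natrM -mulrA; congr (_ * _); case: ifP => le.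
  rewrite mcoeff_deriv submK // mnmBE mnm1E eqxx subn1 prednK ?mulr_natl //.
  by move: le; rewrite lep1mP lt0n.
by move: le; rewrite lep1mP => /negbFE /eqP ->; rewrite mul0r.
Qed.

Lemma eulerD p q : euler (p + q) = euler p + euler q.
Proof. by apply/mpolyP => m; rewrite mcoeffD !mcoeff_euler mcoeffD mulrDr. Qed.

Lemma eulerB p q : euler (p - q) = euler p - euler q.
Proof. by apply/mpolyP => m; rewrite mcoeffB !mcoeff_euler mcoeffB mulrBr. Qed.

Lemma eulerM p q : euler (p * q) = euler p * q + p * euler q.
Proof.
rewrite /euler mulr_suml mulr_sumr -big_split /=; apply: eq_bigr => i _.
by rewrite mderivM -!mul_mpolyC; ring.
Qed.

Lemma euler_homog d g : g \is d.-homog for (wdeg alpha) -> euler g = d%:R *: g.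
Proof.
move=> hg; apply/mpolyP => m; rewrite mcoeff_euler mcoeffZ.
have [<-//|ne] := eqVneq (wdeg alpha m) d.
by rewrite (dhomog_nemf_coeff hg ne) !mulr0.
Qed.

Lemma euler_comp h (Phi : 2.-tuple {mpoly K[2]}) :
  euler (h \mPo Phi) = \sum_j (h^`M(j) \mPo Phi) * euler (tnth Phi j).
Proof.
elim/mpoly_ring_ind: h => [c|i|p q Hp Hq|p q Hp Hq].
- rewrite comp_mpolyC /euler !big1 // => i _; rewrite mderivC ?mulr0 ?scaler0 //.
  by rewrite comp_mpoly0 mul0r.
- rewrite comp_mpolyXU (bigD1 i) //= mderivX mnm1E eqxx scale1r.
  rewrite (_ : (U_(i) - U_(i))%MM = 0%MM); last first.
    by apply/mnmP => j; rewrite mnmBE subnn mnm0E.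
  rewrite mpolyX0 comp_mpoly1 mul1r -tnth_nth big1 ?addr0 // => j ne.
  by rewrite mderivX mnm1E eq_sym (negbTE ne) scale0r comp_mpoly0 mul0r.
- rewrite comp_mpolyD eulerD Hp Hq -big_split /=; apply: eq_bigr => j _.
  by rewrite mderivD comp_mpolyD mulrDl.
- rewrite rmorphM /= eulerM Hp Hq mulr_suml mulr_sumr -big_split /=.
  apply: eq_bigr => j _; rewrite mderivM comp_mpolyD !rmorphM /= mulrDl.
  by congr (_ + _); [rewrite mulrAC | rewrite mulrA].
Qed.

End Euler.

(** * Translations and truncated power series *)

Section Translate.
Variable K : fieldType.
Implicit Types (p : {mpoly K[2]}) (v : 'I_2 -> K).

Definition shift v : 2.-tuple {mpoly K[2]} := [tuple 'X_i + (v i)%:MP | i < 2].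

Lemma shiftXU v i : 'X_i \mPo shift v = 'X_i + (v i)%:MP.
Proof. by rewrite comp_mpolyXU -tnth_nth tnth_mktuple. Qed.

Lemma mderiv_shift v p j : (p \mPo shift v)^`M(j) = p^`M(j) \mPo shift v.
Proof.
elim/mpoly_ring_ind: p => [c|i|p q Hp Hq|p q Hp Hq].
- by rewrite comp_mpolyC mderivC comp_mpoly0.
- rewrite shiftXU mderivD mderivC addr0 mderivX mnm1E.
  case: eqP => [->|_]; last by rewrite !scale0r comp_mpoly0.
  rewrite (_ : (U_(j) - U_(j))%MM = 0%MM) ?scale1r ?mpolyX0 ?comp_mpoly1 //.
  by apply/mnmP => l; rewrite mnmBE subnn mnm0E.
- by rewrite comp_mpolyD !mderivD Hp Hq comp_mpolyD.
- by rewrite rmorphM /= !mderivM Hp Hq comp_mpolyD !rmorphM.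
Qed.

Lemma shiftK v p : (p \mPo shift v) \mPo shift (fun i => - v i) = p.
Proof.
elim/mpoly_ring_ind: p => [c|i|p q Hp Hq|p q Hp Hq].
- by rewrite !comp_mpolyC.
- by rewrite shiftXU comp_mpolyD shiftXU comp_mpolyC mpolyCN subrK.
- by rewrite !comp_mpolyD Hp Hq.
- by rewrite !rmorphM /= Hp Hq.
Qed.

End Translate.

Section Mord.
Variable R : realType.
Local Notation C := (Cplx R).
Implicit Types (p q r : {mpoly C[2]}).

Lemma mordD N p q : mord N p -> mord N q -> mord N (p + q).
Proof. by move=> P Q m lt; rewrite mcoeffD P ?Q ?addr0. Qed.

Lemma mordN N p : mord N p -> mord N (- p).
Proof. by move=> P m lt; rewrite mcoeffN P ?oppr0. Qed.

Lemma mordM N N' p q : mord N p -> mord N' q -> mord (N + N') (p * q).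
Proof.
move=> /mord_bigO P /mord_bigO Q; apply: bigO_mord.
by apply: ext_bigO (bigOM P Q) => z; rewrite /eval mevalM.
Qed.

Lemma mordMl N p q : mord N q -> mord N (p * q).
Proof. by apply: (@mordM 0) => m; rewrite ltn0. Qed.

Lemma mord_euler alpha N p : mord N p -> mord N (euler alpha p).
Proof. by move=> P m lt; rewrite mcoeff_euler P ?mulr0. Qed.

Lemma mord1 p : p@_0 = 0 -> mord 1 p.
Proof. by move=> p0 m; rewrite ltnS leqn0 mdeg_eq0 => /eqP ->. Qed.

Lemma eval0 p : eval p 0 = p@_0.
Proof.
have: bigO 1 (eval (p - (p@_0)%:MP)).
  by apply/mord_bigO/mord1; rewrite mcoeffB mcoeffC eqxx mulr1 subrr.
case=> M _ /nbhs_singleton; rewrite normr0 expr1 mulr0 normr_le0 /eval => /eqP.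
by rewrite mevalB mevalC => /subr0_eq.
Qed.

Lemma bigO_at0 N (F : 'rV[C]_2 -> C) : bigO N.+1 F -> F 0 = 0.
Proof.
case=> M _ /nbhs_singleton.
by rewrite normr0 expr0n mulr0 normr_le0 => /eqP.
Qed.

(** The geometric series of 1 - p / p(0), cut off at order N. *)
Lemma mord_inv N p : p@_0 != 0 -> exists q, mord N (p * q - 1).
Proof.
move=> c0; set c := p@_0 in c0; pose w := 1 - c^-1%:MP * p.
have ordw : mord 1 w.
  by apply: mord1; rewrite mcoeffB mcoeffCM mcoeff1 eqxx mulVf ?subrr.
exists (c^-1%:MP * \sum_(i < N) w ^+ i).
have -> : p * (c^-1%:MP * \sum_(i < N) w ^+ i) - 1 = - w ^+ N.
  have /eqP := subrX1 w N; rewrite subr_eq => /eqP ->.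
  by rewrite /w; ring.
apply: mordN; elim: N => [|N IH]; first by move=> m; rewrite ltn0.
by rewrite exprS -add1n; apply: mordM.
Qed.

(** A monomial of degree at least 2n is divisible by 'X_0 ^+ n or
'X_1 ^+ n. *)
Lemma mord_split n r : mord (n + n) r ->
  exists r0 r1, r = r0 * 'X_0 ^+ n + r1 * 'X_1 ^+ n.
Proof.
move=> ordr; rewrite [r]mpolyE.
have : {subset msupp r <= msupp r} by [].
elim: {1 3}(msupp r) => [|m s IH] sub.
  by exists 0, 0; rewrite big_nil !mul0r addr0.
have [|r0 [r1 E]] := IH; first by move=> m' m's; rewrite sub // inE m's orbT.
rewrite big_cons E.
have le : (n + n <= mdeg m)%N.
  rewrite leqNgt; apply/negP => /ordr /eqP; apply/negP.
  by rewrite -mcoeff_msupp sub // mem_head.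
have [i ni] : exists i, (n <= m i)%N.
  apply: contrapT => /forallNP no.
  have := no 0; have := no 1 => /negP; rewrite -ltnNge => n1 /negP; rewrite -ltnNge => n0.
  move: le; rewrite mdegE big_ord_recl big_ord1.
  by rewrite ord2_0 ord2_lift; move: n0 n1; lia.
have [t mE] : exists t : {mpoly C[2]}, 'X_[m] = t * 'X_i ^+ n.
  exists 'X_[m - U_(i) *+ n]; rewrite mpolyXn -mpolyXD submK //.
  apply/mnm_lepP => j.
  by rewrite mulmnE mnm1E; case: eqP => [<-|]; rewrite ?mul1n ?mul0n.
have [iE|iE] := ord2P i.
- exists ((r@_m)%:MP * t + r0), r1.
  by rewrite -mul_mpolyC mE iE mulrDl mulrA addrA.
- exists r0, ((r@_m)%:MP * t + r1).
  rewrite -mul_mpolyC mE iE mulrA mulrDl.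
  by move: (r0 * _) (_ * 'X_1 ^+ n) => a b; rewrite addrCA.
Qed.

End Mord.

(** * Quasi-homogeneous germs lie in their Jacobian ideal *)

Section QuasiHomogeneousJets.
Variable R : realType.
Local Notation C := (Cplx R).
Local Notation C2 := 'rV[C]_2.
Implicit Types (p q g h : {mpoly C[2]}).

Lemma holomorphic_bigO1 (F : C2 -> C) : holomorphic_at0 F -> F 0 = 0 -> bigO 1 F.
Proof.
move=> /(holomorphic_taylor 1) [p O] F0.
have p0 : p@_0 = 0.
  by have := bigO_at0 O; rewrite F0 sub0r eval0 => /eqP; rewrite oppr_eq0 => /eqP.
apply: ext_bigO (bigOD O (mord_bigO (mord1 p0))) => z.
by rewrite subrK.
Qed.

Lemma holomorphic_map_taylor N (phi : C2 -> C2) : holomorphic_map_at0 phi ->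
  exists Phi : 2.-tuple {mpoly C[2]},
    forall i, bigO N (fun z => phi z 0 i - eval (tnth Phi i) z).
Proof.
move=> hol; pose P i := projT1 (cid (holomorphic_taylor N (hol i))).
exists [tuple P i | i < 2] => i; rewrite tnth_mktuple /P.
by case: cid.
Qed.

Lemma eval_comp p (Phi : 2.-tuple {mpoly C[2]}) z :
  eval (p \mPo Phi) z = eval p (\row_i eval (tnth Phi i) z).
Proof. by rewrite /eval comp_mpoly_meval; apply: meval_eq => i; rewrite mxE. Qed.

Lemma bigO_taylor0 N (F : C2 -> C) p : bigO N (fun z => F z - eval p z) -> bigO 0 F.
Proof.
move=> O; apply: ext_bigO (bigOD (bigO_leq (leq0n _) O) (bigO_eval p)) => z.
by rewrite subrK.
Qed.

Lemma bigO_eval_taylor N p (phi : C2 -> C2) (Phi : 2.-tuple {mpoly C[2]}) :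
  (forall i, bigO N (fun z => phi z 0 i - eval (tnth Phi i) z)) ->
  bigO 0 (fun z => eval p (phi z)) /\
  bigO N (fun z => eval p (phi z) - eval (p \mPo Phi) z).
Proof.
move=> O; have [||//|b s] := @bigO_eval_sub _ N p phi
  (fun z => \row_i eval (tnth Phi i) z).
- by move=> i; apply: bigO_taylor0 (O i).
- by move=> i; apply: ext_bigO (bigO_eval (tnth Phi i)) => z; rewrite mxE.
- by move=> i; apply: ext_bigO (O i) => z; rewrite mxE.
split; first exact: b.
apply: ext_bigO s => z; congr (_ - _).
exact/esym/eval_comp.
Qed.

Lemma bigO_sum N (F : 'I_2 -> C2 -> C) :
  (forall j, bigO N (F j)) -> bigO N (fun z => \sum_j F j z).
Proof.
move=> O; apply: ext_bigO (bigOD (O ord0) (O (lift ord0 ord0))) => z.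
by rewrite big_ord_recl big_ord1.
Qed.

(** Apply the Euler field E to h o Phi = a g.  The left side becomes the sum of
the (h_j o Phi) E(Phi_j), the right side U g with U = E(a) + d a.  As
U(0) = d a(0) is not 0, U is invertible to order N, so g, and with it
h o Phi = a g, is a combination of the h_j o Phi. *)
Lemma weighted_homog_jet N alpha d g a h (Phi : 2.-tuple {mpoly C[2]}) :
  (0 < d)%N -> g \is d.-homog for (wdeg alpha) -> a@_0 != 0 ->
  mord N (h \mPo Phi - a * g) ->
  exists W : 'I_2 -> {mpoly C[2]},
    mord N (h \mPo Phi - \sum_j (h^`M(j) \mPo Phi) * W j).
Proof.
move=> d0 hg a0 ord; pose U := euler alpha a + d%:R *: a.
have U0 : U@_0 != 0.
  rewrite mcoeffD mcoeff_euler mcoeffZ /wdeg big1; last by move=> i _; rewrite mnm0E muln0.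
  by rewrite mul0r add0r mulf_neq0 // pnatr_eq0 -lt0n.
have [V ordV] := mord_inv N U0.
exists (fun j => a * V * euler alpha (tnth Phi j)).
have ordE := mord_euler alpha ord.
have E : euler alpha (h \mPo Phi - a * g) =
    \sum_j (h^`M(j) \mPo Phi) * euler alpha (tnth Phi j) - U * g.
  rewrite -euler_comp eulerB eulerM (euler_homog hg) /U mulrDl.
  by rewrite -scalerAr scalerAl.
rewrite (_ : \sum_j _ = a * V * \sum_j (h^`M(j) \mPo Phi) * euler alpha (tnth Phi j));
  last by rewrite mulr_sumr; apply: eq_bigr => j _; rewrite mulrCA.
clear U0; move: (h \mPo Phi) (\sum_j _) U ordV ord ordE E => x S U ordV ord ordE E.
rewrite (_ : _ - _ = (x - a * g) - (a * V * euler alpha (x - a * g) + a * g * (U * V - 1)));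
  last by rewrite E; ring.
by apply: (mordD ord); apply: mordN; apply: mordD; apply: mordMl.
Qed.

(** [weighted_homog_jet] puts h o phi in the ideal of the h_j o phi; composing
with psi, the inverse of phi, puts h in the ideal of the h_j.  The
cofactors, now germs W_j o psi, are replaced by Taylor polynomials. *)
Lemma quasi_homogeneous_jet h N : quasi_homogeneous (eval h) -> eval h 0 = 0 ->
  exists B : 'I_2 -> {mpoly C[2]}, mord N (h - \sum_j h^`M(j) * B j).
Proof.
move=> [phi [a [alpha [d [g [cc [hola a0] apos hg E]]]]]] h0.
have [holphi phi0 [psi [holpsi psi0 _ phipsi]]] := cc.
have psi1 i : bigO 1 (fun z => psi z 0 i).
  by apply: holomorphic_bigO1; [exact: holpsi | rewrite psi0 mxE].
have [d0|d_gt0] := posnP d.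
  (* In degree 0, g is constant, and it is 0 because h vanishes at the origin. *)
  have g_cst : g = (g@_0)%:MP.
    apply/mpolyP => m; rewrite mcoeffC; have [->|m0] := eqVneq m 0%MM.
      by rewrite mulr1.
    rewrite mulr0 (dhomog_nemf_coeff hg) //= d0 -lt0n.
    by apply: leq_trans (mdeg_le_wdeg apos m); rewrite lt0n mdeg_eq0.
  have g0 : g = 0.
    have := nbhs_singleton E; rewrite phi0 h0 g_cst /eval mevalC => /esym/eqP.
    by rewrite mulf_eq0 (negbTE a0) => /eqP ->.
  exists (fun=> 0); rewrite big1 ?subr0 => [|j _]; last by rewrite mulr0.
  apply: bigO_mord; apply: (eq_bigO (F := fun=> 0)); last first.
    by exists 0 => //; near=> z; rewrite mul0r normr0.
  apply: filterS2 phipsi (near_comp psi1 E) => z phiz Ez.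
  by rewrite -[in RHS]phiz Ez g0 /eval meval0 mulr0.
have [Phi OPhi] := holomorphic_map_taylor N holphi.
have [Psi OPsi] := holomorphic_map_taylor N holpsi.
(* One order more than for phi and psi, so that pa(0) = a(0) even if N = 0. *)
have [pa Oa] := holomorphic_taylor N.+1 hola.
have ord : mord N (h \mPo Phi - pa * g).
  apply: bigO_mord.
  have [_ O1] := bigO_eval_taylor h OPhi.
  have O2 : bigO N (fun z => (a z - eval pa z) * eval g z).
    exact: bigOM0 (bigO_leq (leqnSn N) Oa) (bigO_eval g).
  apply: eq_bigO (bigOB O2 O1).
  near=> z; rewrite [in eval h (phi z)](near E z) //.
  by rewrite /eval mevalB mevalM; ring.
have pa0 : pa@_0 != 0.
  by have := bigO_at0 Oa; rewrite eval0 => /subr0_eq <-.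
have [W ordW] := weighted_homog_jet d_gt0 hg pa0 ord.
have O3 : bigO N (fun z => eval h (phi z) - \sum_j eval h^`M(j) (phi z) * eval (W j) z).
  have [_ Oh] := bigO_eval_taylor h OPhi.
  have Oj j : bigO N (fun z =>
      (eval h^`M(j) (phi z) - eval (h^`M(j) \mPo Phi) z) * eval (W j) z).
    have [_ O] := bigO_eval_taylor h^`M(j) OPhi.
    exact: bigOM0 O (bigO_eval (W j)).
  apply: ext_bigO (bigOB (bigOD Oh (mord_bigO ordW)) (bigO_sum Oj)) => z.
  under [X in _ - X = _]eq_bigr do rewrite mulrBl.
  rewrite sumrB [eval (_ - _) z]mevalB [(\sum_j _).@[_]]raddf_sum /=.
  under [X in _ + (_ - X) - _ = _]eq_bigr do rewrite mevalM.
  by rewrite /eval; ring.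
exists (fun j => W j \mPo Psi); apply: bigO_mord.
have Oj j : bigO N (fun w =>
    eval h^`M(j) w * (eval (W j) (psi w) - eval (W j \mPo Psi) w)).
  have [_ O] := bigO_eval_taylor (W j) OPsi.
  exact: bigO0M (bigO_eval _) O.
apply: eq_bigO (bigOD (bigO_comp psi1 O3) (bigO_sum Oj)).
near=> w.
have -> : (fun z => eval h (phi z) - \sum_j eval h^`M(j) (phi z) * eval (W j) z) \o psi =
  fun w => eval h (phi (psi w)) - \sum_j eval h^`M(j) (phi (psi w)) * eval (W j) (psi w).
  by [].
rewrite (near phipsi w) //.
under [X in _ + X = _]eq_bigr do rewrite mulrBr.
rewrite sumrB [RHS]mevalB [(\sum_j _).@[_]]raddf_sum /=.
under [X in _ = _ - X]eq_bigr do rewrite mevalM.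
by rewrite /eval; ring.
Unshelve. all: by end_near. Qed.

End QuasiHomogeneousJets.

(** * The ideal generated by the derivatives and the square of f *)

Section BaseChange.
Variables (k K : fieldType) (iota : {rmorphism k -> K}).
Local Notation "p ^iota" := (map_mpoly iota p) (at level 2, format "p ^iota").
Implicit Types (f : {mpoly k[2]}).

Lemma mderiv_map_mpoly f i : f^iota^`M(i) = (f^`M(i))^iota.
Proof.
by apply/mpolyP => m; rewrite mcoeff_deriv !mcoeff_map_mpoly mcoeff_deriv raddfMn.
Qed.

Lemma map_upoly_at i (chi : {poly k}) :
  upoly_at i (map_poly iota chi) = (upoly_at i chi)^iota.
Proof.
rewrite /upoly_at -[in LHS](map_mpolyX iota) -horner_map /=; congr (_.[_]).
by apply/polyP => j; rewrite !coef_map /= map_mpolyC.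
Qed.

Lemma jacob_map f p : jacob f p -> jacob f^iota p^iota.
Proof.
case=> a [b ->]; exists a^iota, b^iota.
by rewrite !mderiv_map_mpoly rmorphD !rmorphM.
Qed.

Lemma square_ideal_descent f :
  (exists a b c, f^iota = a * f^iota^`M(0) + b * f^iota^`M(1) + c * f^iota ^+ 2) ->
  exists a b c, f = a * f^`M(0) + b * f^`M(1) + c * f ^+ 2.
Proof.
case=> a [b [c E]]; apply: (map_mpoly_ideal3 (iota := iota) (a0 := a) (a1 := b) (a2 := c)).
by rewrite rmorphXn /= -!mderiv_map_mpoly.
Qed.

End BaseChange.

(** [quasi_homogeneous_jet] at order 2n, moved from the origin to v. *)
Lemma quasi_homogeneous_local (R : realType) (f : {mpoly (Cplx R)[2]})
    (v : 'I_2 -> Cplx R) n :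
  quasi_homogeneous (fun z => eval f (\row_i v i + z)) -> f.@[v] = 0 ->
  exists b0 b1 r0 r1, f = b0 * f^`M(0) + b1 * f^`M(1) +
    (r0 * ('X_0 - (v 0)%:MP) ^+ n + r1 * ('X_1 - (v 1)%:MP) ^+ n).
Proof.
move=> qh fv; pose h := f \mPo shift v.
have hE z : eval h z = eval f (\row_i v i + z).
  rewrite /eval comp_mpoly_meval; apply: meval_eq => i.
  by rewrite tnth_mktuple mevalD mevalXU mevalC !mxE addrC.
have [||B ordB] := @quasi_homogeneous_jet _ h (n + n).
- by rewrite (_ : eval h = fun z => eval f (\row_i v i + z)) //; apply/funext.
- by rewrite hE -fv; apply: meval_eq => i; rewrite !mxE addr0.
have [r0 [r1 E]] := mord_split ordB.
pose back (p : {mpoly (Cplx R)[2]}) := p \mPo shift (fun i => - v i).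
have backD p q : back (p + q) = back p + back q by exact: comp_mpolyD.
have backM p q : back (p * q) = back p * back q by exact: rmorphM.
have backX i : back ('X_i ^+ n) = ('X_i - (v i)%:MP) ^+ n.
  by rewrite /back rmorphXn /= shiftXU mpolyCN.
have backh : back h = f by exact: shiftK.
have backh' j : back h^`M(j) = f^`M(j) by rewrite /back mderiv_shift shiftK.
clearbody back; exists (back (B 0)), (back (B 1)), (back r0), (back r1).
move/(canRL (subrK _)): E; rewrite big_ord_recl big_ord1.
rewrite ord2_0 ord2_lift.
move=> hE'; have fE := congr1 back hE'; rewrite backh in fE.
rewrite [LHS]fE; clear fE hE'.
move: (backh' 0) (backh' 1) (backX 0) (backX 1); clear backX backh backh'.
move: h^`M(0) h^`M(1) ('X_0 ^+ n) ('X_1 ^+ n) => h0 h1 x0 x1 <- <- <- <-.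
by rewrite !backD !backM addrC [back h0 * _]mulrC [back h1 * _]mulrC.
Qed.

Lemma quasi_homogeneous_mem_square_ideal (R : realType) (k : fieldType)
    (iota : {rmorphism k -> Cplx R}) (f : {mpoly k[2]}) :
  (forall i, exists2 chi, chi != 0 & jacob f (upoly_at i chi)) ->
  (forall p : 'rV[Cplx R]_2,
     singular_point iota f p -> quasi_homogeneous_at iota f p) ->
  exists a b c, f = a * f^`M(0) + b * f^`M(1) + c * f ^+ 2.
Proof.
move=> fin qh; apply: (square_ideal_descent (iota := iota)).
apply: mem_square_ideal.
- move=> i; have [chi chi0 J] := fin i; exists (map_poly iota chi).
    by rewrite map_poly_eq0.
  by rewrite map_upoly_at; apply: jacob_map.
- move=> v v0 v1 v2 n; apply: quasi_homogeneous_local; last exact: v0.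
  have ev (p : {mpoly k[2]}) : evalC iota p (\row_i v i) = (map_mpoly iota p).@[v].
    by rewrite /evalC /eval; apply: meval_eq => i; rewrite mxE.
  apply: qh; split; rewrite ev; first exact: v0.
    by rewrite -mderiv_map_mpoly; exact: v1.
  by rewrite -mderiv_map_mpoly; exact: v2.
Qed.

(** * Generators of the module *)

Section Generators.
Variable k : fieldType.
Local Notation A := {mpoly k[2]}.
Implicit Types (f a b c : A) (v w : form1 k).

Lemma form1P v w : v 0 0 = w 0 0 -> v 0 1 = w 0 1 -> v = w.
Proof.
by move=> e0 e1; apply/rowP => i; have [->|->] := ord2P i.
Qed.

Lemma wedge_diff1 f v : wedge (diff1 f) v = f^`M(0) * v 0 1 - f^`M(1) * v 0 0.
Proof. by rewrite /wedge !mxE. Qed.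

Lemma submodule_gen4P f w v :
  submodule_gen [:: f *: dx k; f *: dy k; diff1 f; w] v <->
  exists c0 c1 c2 c3, v 0 0 = c0 * f + c2 * f^`M(0) + c3 * w 0 0 /\
                      v 0 1 = c1 * f + c2 * f^`M(1) + c3 * w 0 1.
Proof.
split=> [[c ->]|[c0 [c1 [c2 [c3 [e0 e1]]]]]].
  exists (c ord0), (c (lift ord0 ord0)), (c (lift ord0 (lift ord0 ord0))),
    (c (lift ord0 (lift ord0 (lift ord0 ord0)))).
  by rewrite !big_ord_recl big_ord0 /= !mxE /=; split; ring.
exists (fun i : 'I_4 => [:: c0; c1; c2; c3]`_i).
by apply: form1P; rewrite ?e0 ?e1 !big_ord_recl big_ord0 /= !mxE /=; ring.
Qed.

(** If df /\ v = f t, then v - t w - c f v is killed by the wedge product with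
df, because t - t (1 - c f) = c f t = c (df /\ v); by the hypothesis on
syzygies it is a multiple of df. *)
Lemma Emod_generated f a b c :
  (forall P Q, f^`M(0) * Q = f^`M(1) * P ->
    exists e, P = e * f^`M(0) /\ Q = e * f^`M(1)) ->
  f = a * f^`M(0) + b * f^`M(1) + c * f ^+ 2 ->
  exists2 w : form1 k, Emod f w &
    Emod f = submodule_gen [:: f *: dx k; f *: dy k; diff1 f; w].
Proof.
move=> syz fE; pose w : form1 k := \row_i if i == 0 then - b else a.
have w0 : w 0 0 = - b by rewrite mxE.
have w1 : w 0 1 = a by rewrite mxE.
have abE : a * f^`M(0) + b * f^`M(1) = f * (1 - c * f).
  by rewrite mulrBr mulr1 [X in X - _]fE; ring.
exists w; first by exists (1 - c * f); rewrite wedge_diff1 w0 w1 -abE; ring.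
apply/seteqP; split=> v.
  case=> t; rewrite wedge_diff1 => tE; apply/submodule_gen4P.
  have [|e [P Q]] := syz (v 0 0 + t * b - c * v 0 0 * f) (v 0 1 - t * a - c * v 0 1 * f).
    apply/eqP; rewrite -subr_eq0; apply/eqP.
    transitivity ((f^`M(0) * v 0 1 - f^`M(1) * v 0 0) * (1 - c * f)
       - t * (a * f^`M(0) + b * f^`M(1))); first by ring.
    by rewrite tE abE; ring.
  exists (c * v 0 0), (c * v 0 1), e, t; rewrite w0 w1 -P -Q; split; ring.
case/submodule_gen4P => c0 [c1 [c2 [c3 [e0 e1]]]].
exists (c1 * f^`M(0) - c0 * f^`M(1) + c3 * (1 - c * f)).
rewrite wedge_diff1 e0 e1 w0 w1.
transitivity (f * (c1 * f^`M(0) - c0 * f^`M(1)) + c3 * (a * f^`M(0) + b * f^`M(1))).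
  by ring.
by rewrite abE; ring.
Qed.

End Generators.

Theorem theorem1 (R : realType) (k : fieldType) (iota : {rmorphism k -> Cplx R})
    (f : {mpoly k[2]}) :
  tame f ->
  (forall p : 'rV[Cplx R]_2,
     singular_point iota f p -> quasi_homogeneous_at iota f p) ->
  exists2 w : form1 k, Emod f w &
    Emod f = submodule_gen [:: f *: dx k; f *: dy k; diff1 f; w].
Proof.
move=> tame_f qh.
have fin i := fin_dim_quotient_upoly i (tame_fin_dim tame_f).
have [a [b [c fE]]] := quasi_homogeneous_mem_square_ideal fin qh.
by apply: Emod_generated fE => P Q; apply: jacob_syzygy.
Qed.
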